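(* Assume: (a) $c>20$ is a fixed constant, and $(n,p,k)\to\infty$ with $p/n\to c$; (b) the signal strength $\beta>0$, either fixed or growing with $n,p$, satisfies $\beta\le\sqrt{p/n}$; (c) the sparsity level $k$ satisfies $k\ge 2p/\sqrt n$, and $k/p\to0$; (d) $k/(p/\log^2p)\to0$. Then, with probability tending to one as $(n,p,k)\to\infty$, every rank-one matrix $Y=\mathbf y\mathbf y^T$ ($\mathbf y\in\mathbb R^p$) that is feasible for the semidefinite program $$\operatorname{argmax}\{\langle\hat\Sigma,X\rangle : X\in\mathcal S^p_+,\ \operatorname{tr}(X)=1,\ \|X\|_S\le k\}$$ satisfies $$\langle\hat\Sigma,Y\rangle\le\frac89\cdot\frac pn.$$
   Context: Single-spike model: the spike $\mathbf z\in\mathbb R^p$ is a deterministic unit-length vector with exactly $k$ nonzero entries, each equal to $+1/\sqrt k$ or $-1/\sqrt k$. The samples are $\mathbf x_i=\sqrt{\beta}\,u_i\,\mathbf z+\boldsymbol\xi_i$ for $i=1,\dots,n$, where $\beta>0$ is the signal strength, $u_i\sim N(0,1)$, the vectors $\boldsymbol\xi_i\in\mathbb R^p$ have i.i.d. $N(0,1)$ entries, and all the $u_i$'s and $\boldsymbol\xi_i$'s are mutually independent. The sample covariance matrix is $\hat\Sigma=\frac1n\sum_{i=1}^n\mathbf x_i\mathbf x_i^T$. For $p\times p$ real matrices, $\langle A,B\rangle=\sum_{i,j}A_{ij}B_{ij}=\operatorname{tr}(A^TB)$, $\|X\|_S=\sum_{i,j}|X_{ij}|$, and $\mathcal S^p_+$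 is the cone of symmetric positive semidefinite $p\times p$ matrices. The parameter $k$ in the semidefinite program equals the sparsity of the spike. Asymptotic statements refer to sequences $p=p(n)$, $k=k(n)$ with $n\to\infty$, $p\to\infty$, $k\to\infty$. *)

(* Defs.v *)
From HB Require Import structures.
From mathcomp Require Import all_boot all_order all_algebra.
From mathcomp Require Import all_classical all_reals all_analysis.

Set Implicit Arguments.
Unset Strict Implicit.
Unset Printing Implicit Defensive.

Import Order.TTheory GRing.Theory Num.Theory.
Import numFieldNormedType.Exports.

Local Open Scope classical_set_scope.
Local Open Scope ring_scope.

(* Equality with [normal_prob] is only required on measurable sets: values of
   measures outside the sigma-algebra carry no meaning. *)
Definition std_normal (R : realType) (d : measure_display)
    (T : measurableType d) (P : probability T R) (X : {RV P >-> R}) : Prop :=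
  forall A : set R, measurable A -> distribution P X A = normal_prob 0 1 A.

Definition mutually_independent (R : realType) (d : measure_display)
    (T : measurableType d) (P : probability T R) (I : finType)
    (X : I -> {RV P >-> R}) : Prop :=
  forall (J : {set I}) (A : I -> set R), (forall i, measurable (A i)) ->
    P (\bigcap_(i in [set i | i \in J]) (X i @^-1` A i)) =
    (\prod_(i in J) P (X i @^-1` A i))%E.

Section Spike.
Context (R : realType) (p : nat).

Definition is_spike (k : nat) (z : 'cV[R]_p) : Prop :=
  [/\ \sum_j z j ord0 ^+ 2 = 1,
      #|[pred j | z j ord0 != 0]| = k &
      forall j, z j ord0 != 0 ->
        z j ord0 = (Num.sqrt k%:R)^-1 \/ z j ord0 = - (Num.sqrt k%:R)^-1].

End Spike.

Section Model.
Context (R : realType) (d : measure_display) (T : measurableType d).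
Context (P : probability T R) (n p : nat).

(* The scalars u_i and the noise entries xi_ij, gathered in one family so that
   independence is joint. *)
Definition model_vars (u : 'I_n -> {RV P >-> R})
    (xi : 'I_n -> 'I_p -> {RV P >-> R})
    (s : 'I_n + 'I_n * 'I_p) : {RV P >-> R} :=
  match s with inl i => u i | inr ij => xi ij.1 ij.2 end.

Definition gaussian_model (u : 'I_n -> {RV P >-> R})
    (xi : 'I_n -> 'I_p -> {RV P >-> R}) : Prop :=
  [/\ forall i, std_normal (u i),
      forall i j, std_normal (xi i j) &
      mutually_independent (model_vars u xi)].

Definition sample (beta : R) (z : 'cV[R]_p) (u : 'I_n -> {RV P >-> R})
    (xi : 'I_n -> 'I_p -> {RV P >-> R}) (w : T) (i : 'I_n) : 'cV[R]_p :=
  (Num.sqrt beta * u i w) *: z + \col_j xi i j w.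

End Model.

Section Matrices.
Context (R : realType) (p : nat).

Definition sample_cov (n : nat) (x : 'I_n -> 'cV[R]_p) : 'M[R]_p :=
  n%:R^-1 *: \sum_(i < n) x i *m (x i)^T.

Definition mxdot (A B : 'M[R]_p) : R := \sum_i \sum_j A i j * B i j.

Definition mxnormS (X : 'M[R]_p) : R := \sum_i \sum_j `|X i j|.

Definition sym_psd (X : 'M[R]_p) : Prop :=
  X^T = X /\ forall v : 'cV[R]_p, 0 <= (v^T *m X *m v) ord0 ord0.

Definition sdp_feasible (k : nat) (X : 'M[R]_p) : Prop :=
  [/\ sym_psd X, \tr X = 1 & mxnormS X <= k%:R].

End Matrices.

(* Main.v *)
Require Import Defs.
From HB Require Import structures.
From mathcomp Require Import all_boot all_order all_algebra.
From mathcomp Require Import all_classical all_reals all_analysis.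
From mathcomp Require Import measurable_realfun.
From mathcomp Require Import ring lra.

Set Implicit Arguments.
Unset Strict Implicit.
Unset Printing Implicit Defensive.

Import Order.TTheory GRing.Theory Num.Theory.
Import numFieldNormedType.Exports.

Local Open Scope classical_set_scope.
Local Open Scope ring_scope.

(* The value of the program at [y y^T] is [|X y|^2 / n], where the rows of [X]
   are the samples.  Feasibility means [|y|_2 = 1] and [|y|_1^2 <= k], so the
   rescaled vector [x = sqrt k y] has [|x|_2^2 = k] and [|x|_1 <= k].

   Rounding.  The convex function [|X x|^2], minus [D] times the sum of the
   piecewise linear interpolations of [t^2] between integers, does not decrease
   when [x] is rounded, in a suitable way, to an integer vector [b] with
   [|b|_1 <= k + 1].  Hence [|X b|^2 <= D |b|^2] for all such [b] implies
   [|X x|^2 <= D (|x|_2^2 + |x|_1)], that is [|X y|^2 <= 2 D].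

   Union bound.  There are at most [(2 p + 1)^(k + 1)] such [b], and
   [|X b|^2 / ((1 + beta) |b|^2)] is dominated by a chi-square variable with [n]
   degrees of freedom, for which [E exp (chi^2 / 4) = 2^(n / 2)].  So
   [D = (1 + beta) (3 n / 2 + 4 (k + 1) ln (2 p + 1))] works outside an event of
   probability at most [(sqrt 2 exp (- 3 / 8))^n].

   As [k ln p = o(n)], the value is eventually at most [(1 + beta) 16 / 5], and
   [(1 + q) 16 / 5 <= 8 / 9 q^2] for [q = sqrt (p / n) >= sqrt 20]. *)

(** * Gaussian integrals *)

Section GaussianIntegrals.
Context (R : realType).
Import HBNNSimple.

(* With [X = id] this integrates against a measure given by a density; with a
   random variable [X] and [g] a product of other variables it turns a
   factorization on events into a factorization of expectations. *)
Lemma ge0_integral_density d d' (T : measurableType d) (T' : measurableType d')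
    (mu : {measure set T -> \bar R}) (nu : {measure set T' -> \bar R})
    (X : T -> T') (g : T -> R) (f : T' -> R) :
  measurable_fun setT X -> measurable_fun setT g -> (forall x, 0 <= g x) ->
  measurable_fun setT f -> (forall y, 0 <= f y) ->
  (forall A, measurable A -> nu A = (\int[mu]_x (g x * \1_A (X x))%:E)%E) ->
  (\int[nu]_y (f y)%:E = \int[mu]_x (g x * f (X x))%:E)%E.
Proof.
move=> mX mg g0 mf f0 nuE.
have mf' : measurable_fun setT (fun y => (f y)%:E) by exact/measurable_EFinP.
(* Monotone convergence along simple functions increasing to [f] reduces the claim to level sets,
   where it is the hypothesis [nuE]. *)
pose h := nnsfun_approx measurableT mf'.
have hf y : EFin (h n y) @[n --> \oo] --> (f y)%:E.
  by have := @cvg_nnsfun_approx _ _ _ _ measurableT _ mf'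
       (fun _ _ => f0 _) y I.
have hnd y : {homo (fun n => h n y) : a b / (a <= b)%N >-> a <= b}.
  by move=> a b ab; exact/lefP/nd_nnsfun_approx.
have mhX n : measurable_fun setT (h n \o X) by exact: measurableT_comp.
have -> : (\int[nu]_y (f y)%:E = limn (fun n => \int[nu]_y (h n y)%:E))%E.
  rewrite -monotone_convergence//.
  - by apply: eq_integral => y _; apply/esym/cvg_lim => //; exact: hf.
  - by move=> n; exact/measurable_EFinP.
  - by move=> n y _; rewrite lee_fin.
  - by move=> y _ a b ab; rewrite lee_fin; exact: hnd.
have -> : (\int[mu]_x (g x * f (X x))%:E
    = limn (fun n => \int[mu]_x (g x * h n (X x))%:E))%E.
  rewrite -monotone_convergence//.
  - apply: eq_integral => x _; apply/esym/cvg_lim => //.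
    exact: (cvgeZl (y := (g x)%:E) isT (hf (X x))).
  - by move=> n; apply/measurable_EFinP/measurable_funM => //; exact: mhX.
  - by move=> n y _; rewrite lee_fin mulr_ge0.
  - by move=> y _ a b ab; rewrite lee_fin ler_wpM2l// hnd.
congr (limn _); apply/funext => n.
under eq_integral do rewrite fimfunE -fsumEFin//.
rewrite ge0_integral_fsum//; last 2 first.
  - by move=> r; exact/measurable_EFinP/measurableT_comp.
  - by move=> r y _; rewrite EFinM nnfun_muleindic_ge0.
under [RHS]eq_integral => x _.
  rewrite EFinM fimfunE -fsumEFin// ge0_mule_fsumr; last first.
    by move=> r; rewrite EFinM nnfun_muleindic_ge0.
  over.
have mind r : measurable_fun setT (fun x => \1_(h n @^-1` [set r]) (X x) : R).
  by apply: measurableT_comp => //; exact: measurable_indic.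
rewrite ge0_integral_fsum//; last 2 first.
  - move=> r; apply/measurable_EFinP; apply: measurable_funM => //.
    exact: measurable_funM.
  - move=> r y _; apply: mule_ge0; [by rewrite lee_fin|].
    by rewrite EFinM nnfun_muleindic_ge0.
apply: eq_fsbigr => r; rewrite inE => -[y _ <-{r}].
under eq_integral do rewrite EFinM.
rewrite ge0_integralZl//; last 2 first.
  - exact/measurable_EFinP.
  - by rewrite lee_fin.
rewrite integral_indic// setIT nuE// -ge0_integralZl//.
- by apply: eq_integral => x _; rewrite -!EFinM; congr EFin; ring.
- by apply/measurable_EFinP; exact: measurable_funM.
- by move=> x _; rewrite lee_fin mulr_ge0.
- by rewrite lee_fin.
Qed.

Lemma integral_normal_prob (m s : R) (f : R -> R) :
  measurable_fun setT f -> (forall x, 0 <= f x) ->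
  (\int[normal_prob m s]_x (f x)%:E
   = \int[lebesgue_measure]_x (normal_pdf m s x * f x)%:E)%E.
Proof.
move=> mf f0; apply: (@ge0_integral_density _ _ _ _ _ _ id) => //.
- exact: measurable_normal_pdf.
- by move=> x; exact: normal_pdf_ge0.
- move=> A mA; rewrite /= /normal_prob integral_mkcond.
  apply: eq_integral => x _; rewrite patchE indicE.
  by case: (x \in A); rewrite ?mulr1 ?mulr0.
Qed.

(** Completing the square: [expR (c * x)] times the density of N(0, 1) is [expR (c ^+ 2 / 2)] times
    the density of N(c, 1). *)
Lemma integral_normal_expRM (c : R) :
  (\int[normal_prob 0 1]_x (expR (c * x))%:E = (expR (c ^+ 2 / 2))%:E)%E.
Proof.
rewrite integral_normal_prob//; last first.
  by apply: measurableT_comp => //; exact: measurable_funM.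
transitivity (\int[lebesgue_measure]_x
    ((expR (c ^+ 2 / 2))%:E * (normal_pdf c 1 x)%:E))%E.
  apply: eq_integral => x _; rewrite -EFinM; congr EFin.
  rewrite !normal_pdfE ?oner_eq0// /normal_fun mulrCA -!mulrA -!expRD.
  by congr (_ * expR _); field.
rewrite ge0_integralZl//.
- by rewrite integral_normal_pdf mule1.
- by apply/measurable_EFinP; exact: measurable_normal_pdf.
- by move=> x _; rewrite lee_fin normal_pdf_ge0.
Qed.

(** The integrand times the density of N(0, 1) is [Num.sqrt 2] times the density of N(0, 2). *)
Lemma integral_normal_expR_sqr :
  (\int[normal_prob 0 1]_x (expR (x ^+ 2 / 4))%:E = (Num.sqrt (2 : R))%:E)%E.
Proof.
rewrite integral_normal_prob//; last first.
  by apply: measurableT_comp => //; apply: measurable_funM => //;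
     exact: measurable_funX.
have s0 : Num.sqrt 2 != 0 :> R by rewrite sqrtr_eq0 -ltNge ltr0n.
have s2 : Num.sqrt (2 : R) ^+ 2 = 2 by rewrite sqr_sqrtr.
transitivity (\int[lebesgue_measure]_x
    ((Num.sqrt (2 : R))%:E * (normal_pdf 0 (Num.sqrt 2) x)%:E))%E.
  apply: eq_integral => x _; rewrite -EFinM; congr EFin.
  rewrite !normal_pdfE ?oner_eq0// /normal_fun /normal_peak s2 -mulrA -expRD.
  rewrite mulrA; congr (_ * expR _); last by field.
  rewrite expr1n mul1r -mulrnAr sqrtrM// invfM mulrA divff// mul1r.
  by [].
rewrite ge0_integralZl//.
- by rewrite integral_normal_pdf mule1.
- by apply/measurable_EFinP; exact: measurable_normal_pdf.
- by move=> x _; rewrite lee_fin normal_pdf_ge0.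
Qed.

End GaussianIntegrals.

(** * Independence and subgaussian vectors *)

Section Independence.
Context (R : realType) (d : measure_display) (T : measurableType d).
Context (P : probability T R) (I : finType) (X : I -> {RV P >-> R}).
Hypothesis indX : mutually_independent X.

Lemma measurable_RV (i : I) (A : set R) :
  measurable A -> measurable (X i @^-1` A).
Proof. by move=> mA; rewrite -[_ @^-1` _]setTI; exact: measurable_funP. Qed.

Lemma measurable_RV_comp (f : R -> R) (i : I) :
  measurable_fun setT f -> measurable_fun setT (fun w => f (X i w)).
Proof. by move=> mf; exact: measurableT_comp. Qed.

(** For indicators this is independence. The factors are then freed one at a time, since two
    measures that agree on events give [f i] the same integral. *)
Lemma integral_prod_indep (f : I -> R -> R) (m : I -> R) :
  (forall i, measurable_fun setT (f i)) -> (forall i x, 0 <= f i x) ->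
  (forall i, \int[P]_w (f i (X i w))%:E = (m i)%:E)%E ->
  (\int[P]_w (\prod_i f i (X i w))%:E = (\prod_i m i)%:E)%E.
Proof.
move=> mf f0 fm.
(* Invariant of the induction: factors outside the list are indicators. For [enum I] it is
   vacuous. *)
have : forall i, i \notin enum I -> exists2 A, measurable A & f i = \1_A.
  by move=> i; rewrite mem_enum.
elim: (enum I) f m mf f0 fm => [|i s IH] f m mf f0 fm fs.
  have /choice[A AP] : forall i, exists A, measurable A /\ f i = \1_A.
    by move=> i; have [//|A mA fA] := fs i; exists A.
  have mi i : P (X i @^-1` A i) = (m i)%:E.
    rewrite -fm (AP i).2 -[X in P X]setIT -integral_indic//.
    by apply: measurable_RV; exact: (AP i).1.
  have := indX [set: I]%SET (fun i => (AP i).1).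
  set B := \bigcap_(i in _) _ => PB.
  have mB : measurable B.
    apply: fin_bigcap_measurable; first exact: finite_finset.
    by move=> i _; exact: (measurable_RV i (AP i).1).
  have prodE w : \prod_i f i (X i w) = \1_B w.
    rewrite indicE; have [Bw|nBw] := pselect (B w).
      rewrite mem_set// big1// => i _; rewrite (AP i).2 indicE mem_set//.
      by apply: Bw; rewrite /= inE.
    rewrite memNset//.
    have [i nAi] : exists i, ~ A i (X i w).
      by apply/existsNP => H; apply: nBw => i _; exact: H.
    by rewrite (bigD1 i)//= (AP i).2 indicE memNset// mul0r.
  under eq_integral do rewrite prodE.
  rewrite integral_indic// setIT.
  apply: etrans PB _; rewrite -prodEFin; by apply: eq_big => i; rewrite ?inE.
pose a := \prod_(j | j != i) m j.
have m0 j : 0 <= m j.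
  by rewrite -lee_fin -(fm j); apply: integral_ge0 => w _; rewrite lee_fin.
have a0 : 0 <= a by apply: prodr_ge0.
pose g w := \prod_j (if j == i then 1 else f j (X j w)).
have gE w (h : R -> R) :
    \prod_j (if j == i then h else f j) (X j w) = g w * h (X i w).
  rewrite /g (bigD1 i)//= eqxx mulrC; congr (_ * _).
  rewrite [RHS](bigD1 i)//= eqxx mul1r.
  by apply: eq_bigr => j /negbTE ->.
(* Weighting [P] by the other factors [g] and pushing forward along [X i] gives [a] times the law of
   [X i]; the induction hypothesis checks this on events. *)
transitivity (\int[mscale (NngNum a0) (distribution P (X i))]_x (f i x)%:E)%E.
  rewrite (@ge0_integral_density _ _ _ _ _ P _ (X i) g)//.
  - apply: eq_integral => w _; rewrite -(gE w (f i)); congr EFin.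
    by apply: eq_bigr => j _; case: eqP => // ->.
  - apply: measurable_prod => j _; case: (j == i) => //.
    exact: measurable_RV_comp.
  - by move=> w; apply: prodr_ge0 => j _; case: ifP.
  - move=> A mA; under [RHS]eq_integral => w _ do rewrite -(gE w \1_A).
    have PA0 : P (X i @^-1` A) = (fine (P (X i @^-1` A)))%:E.
      by rewrite fineK// fin_num_measure//; exact: measurable_RV.
    rewrite (IH (fun j => if j == i then \1_A else f j)
      (fun j => if j == i then fine (P (X i @^-1` A)) else m j)).
    + rewrite (bigD1 i)//= eqxx mulrC EFinM -PA0; congr (_ * _)%E.
      by congr EFin; apply: eq_bigr => j /negbTE ->.
    + by move=> j; case: (j == i) => //; exact: measurable_indic.
    + by move=> j x; case: ifP.
    + move=> j; case: eqP => [->|_]; last exact: fm.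
      by rewrite -PA0 -[X in P X]setIT -integral_indic//; exact: measurable_RV.
    + move=> j js; case: eqP => [_|/eqP ji]; first by exists A.
      by apply: fs; rewrite inE negb_or ji.
rewrite ge0_integral_mscale//; last 2 first.
  - exact/measurable_EFinP.
  - by move=> x _; rewrite lee_fin.
rewrite ge0_integral_distribution//; last 2 first.
  - exact/measurable_EFinP.
  - by move=> x; rewrite lee_fin.
by rewrite fm/= -EFinM mulrC (bigD1 i).
Qed.

Hypothesis normX : forall i, std_normal (X i).

Lemma integral_std_normal (f : R -> R) (i : I) :
  measurable_fun setT f -> (forall x, 0 <= f x) ->
  (\int[P]_w (f (X i w))%:E = \int[normal_prob 0 1]_x (f x)%:E)%E.
Proof.
move=> mf f0.
transitivity (\int[P]_w (1 * f (X i w))%:E)%E.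
  by apply: eq_integral => w _; rewrite mul1r.
refine (esym (@ge0_integral_density R _ _ T _ P (normal_prob 0 1) (X i)
  (cst 1) f _ _ _ _ _ _)) => //.
  exact (@measurable_funPT _ _ _ _ (X i)).
move=> A mA; apply: etrans (esym (normX i mA)) _.
rewrite /distribution /pushforward /= -[X in P X]setIT -integral_indic//;
  last exact: measurable_RV.
by apply: eq_integral => w _; rewrite mul1r.
Qed.

Lemma expR_sum (J : finType) (h : J -> R) :
  expR (\sum_j h j) = \prod_j expR (h j).
Proof. exact: (big_morph _ (@expRD R) (@expR0 R)). Qed.

Lemma integral_expR_indep_normal (a : I -> R) :
  (\int[P]_w (expR (\sum_i a i * X i w))%:E
   = (expR ((\sum_i a i ^+ 2) / 2))%:E)%E.
Proof.
under eq_integral do rewrite expR_sum.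
have me i : measurable_fun setT (fun x => expR (a i * x)).
  by apply: measurableT_comp => //; exact: measurable_funM.
rewrite (@integral_prod_indep (fun i x => expR (a i * x))
  (fun i => expR (a i ^+ 2 / 2)))//.
  by rewrite mulr_suml expR_sum.
by move=> i; rewrite (@integral_std_normal (fun x => expR (a i * x)))//
  integral_normal_expRM.
Qed.

End Independence.

Section Subgaussian.
Context (R : realType) (d : measure_display) (T : measurableType d).
Context (P : probability T R) (J : finType) (G : J -> T -> R).
Hypothesis mG : forall j, measurable_fun setT (G j).
Hypothesis subG : forall a : J -> R,
  (\int[P]_w (expR (\sum_j a j * G j w))%:E
   <= (expR ((\sum_j a j ^+ 2) / 2))%:E)%E.

(** Squares replace linear terms one at a time: exp(G^2 / 4) is the mean of exp(t G / sqrt 2) over a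
    standard normal t, so by Tonelli a square is an average of linear terms. Each one costs a factor
    sqrt 2, the mean of exp(t^2 / 4). *)
Lemma integral_expR_sqr_partial (s : seq J) (a : J -> R) :
  uniq s ->
  (\int[P]_w (expR (\sum_j if j \in s then G j w ^+ 2 / 4
                           else a j * G j w))%:E
   <= ((Num.sqrt 2) ^+ size s *
       expR (\sum_j if j \in s then 0 else a j ^+ 2 / 2))%:E)%E.
Proof.
elim: s a => [|i s IH] a /=.
  move=> _; rewrite mul1r -mulr_suml; exact: subG.
move=> /andP[is_ us].
(* The coefficient t / sqrt 2 adds (t / sqrt 2)^2 / 2 = t^2 / 4 to the exponent of the bound. *)
pose b (t : R) j := if j == i then t / Num.sqrt 2 else a j.
pose E0 w := \sum_j if j == i then 0 else if j \in s then G j w ^+ 2 / 4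
                           else a j * G j w.
pose Q0 := \sum_j if j \in i :: s then 0 else a j ^+ 2 / 2.
have s2 : Num.sqrt (2 : R) ^+ 2 = 2 by rewrite sqr_sqrtr.
have s20 : Num.sqrt 2 != 0 :> R by rewrite sqrtr_eq0 -ltNge ltr0n.
have bE t w : expR (\sum_j if j \in s then G j w ^+ 2 / 4 else b t j * G j w)
    = expR (E0 w) * expR (G i w / Num.sqrt 2 * t).
  rewrite -expRD; congr expR.
  rewrite (bigD1 i)//= /E0 [in RHS](bigD1 i)//= (negbTE is_) eqxx add0r.
  rewrite /b eqxx [LHS]addrC; congr (_ + _); last by ring.
  by apply: eq_bigr => j /negbTE ->.
have aE w : expR (\sum_j if j \in i :: s then G j w ^+ 2 / 4 else a j * G j w)
    = expR (E0 w) * expR ((G i w / Num.sqrt 2) ^+ 2 / 2).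
  rewrite -expRD; congr expR.
  rewrite (bigD1 i)//= /E0 [in RHS](bigD1 i)//= inE eqxx add0r addrC/=.
  congr (_ + _).
    by apply: eq_bigr => j /negbTE ji; rewrite inE ji.
  by rewrite expr_div_n s2; field.
have qE t : \sum_j (if j \in s then 0 else b t j ^+ 2 / 2) = Q0 + t ^+ 2 / 4.
  rewrite (bigD1 i)//= /Q0 [in RHS](bigD1 i)//= (negbTE is_) inE eqxx/= add0r.
  rewrite addrC; congr (_ + _).
    by apply: eq_bigr => j /negbTE ji; rewrite /b inE ji.
  by rewrite /b eqxx expr_div_n s2; field.
have mE0 : measurable_fun setT E0.
  apply: measurable_sum => j; case: (j == i) => //; case: (j \in s).
    by apply: measurable_funM => //; exact: measurable_funX.
  exact: measurable_funM.
pose F (wt : T * R) :=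
  (expR (E0 wt.1) * expR (G i wt.1 / Num.sqrt 2 * wt.2))%:E.
have mF : measurable_fun setT F.
  apply/measurable_EFinP; apply: measurable_funM.
    by apply: measurableT_comp => //; exact: measurableT_comp.
  apply: measurableT_comp => //; apply: measurable_funM => //.
  by apply: measurable_funM => //; exact: measurableT_comp.
have F0 wt : (0 <= F wt)%E by rewrite lee_fin mulr_ge0// expR_ge0.
have -> : (\int[P]_w (expR (\sum_j if j \in i :: s then G j w ^+ 2 / 4
                           else a j * G j w))%:E
    = \int[P]_w \int[normal_prob 0 1]_t F (w, t))%E.
  apply: eq_integral => w _; rewrite aE EFinM -integral_normal_expRM.
  rewrite -ge0_integralZl//.
  by apply/measurable_EFinP; apply: measurableT_comp => //;
     exact: measurable_funM.
rewrite fubini_tonelli//.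
apply: (@le_trans _ _ (\int[normal_prob 0 1]_t
    ((Num.sqrt 2 ^+ size s * expR Q0) * expR (t ^+ 2 / 4))%:E)%E).
  apply: ge0_le_integral => //.
  - by move=> t _; apply: integral_ge0.
  - exact: measurable_fun_fubini_tonelli_G.
  - apply/measurable_EFinP; apply: measurable_funM => //.
    by apply: measurableT_comp => //; apply: measurable_funM => //;
       exact: measurable_funX.
  - move=> t _; have := IH (b t) us.
    by under eq_integral do rewrite bE; rewrite qE expRD mulrA.
under eq_integral do rewrite EFinM.
rewrite ge0_integralZl//.
  by rewrite integral_normal_expR_sqr -EFinM lee_fin mulrAC exprSr.
by apply/measurable_EFinP; apply: measurableT_comp => //;
   apply: measurable_funM => //; exact: measurable_funX.
Qed.

Lemma integral_expR_sqr_subgaussian :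
  (\int[P]_w (expR ((\sum_j G j w ^+ 2) / 4))%:E
   <= ((Num.sqrt 2) ^+ #|J|)%:E)%E.
Proof.
have := integral_expR_sqr_partial (fun=> 0) (enum_uniq J).
rewrite [X in expR X]big1 ?expR0 ?mulr1 -?cardE; last first.
  by move=> j _; rewrite mem_enum.
under eq_integral => w _.
  under eq_bigr do rewrite mem_enum/=.
  rewrite -mulr_suml; over.
by [].
Qed.

End Subgaussian.

(** * Rounding to integer vectors *)

Section Rounding.
Context (R : realType).

(* Moving mass between two fractional coordinates until one of them becomes
   integral preserves the sum; only the last coordinate left can increase it. *)
Lemma round_cube (I : finType) (F : (I -> R) -> R) :
  (forall (x v : I -> R) (t1 t2 : R), 0 <= t1 -> 0 <= t2 ->
     F x <= F (fun i => x i + t2 * v i) \/ F x <= F (fun i => x i - t1 * v i)) ->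
  forall x : I -> R, (forall i, 0 <= x i <= 1) ->
  exists e : I -> bool,
    \sum_i (e i)%:R <= \sum_i x i + 1 /\ F x <= F (fun i => (e i)%:R).
Proof.
move=> Fqc x.
have [n] := ubnP #|[pred i | 0 < x i < 1]|.
elim: n x => // n IH x xn x01.
have done01 (y : I -> R) : (forall i, (y i == 0) || (y i == 1)) ->
    exists e : I -> bool, forall i, y i = (e i)%:R.
  move=> y01; exists (fun i => y i == 1) => i.
  by case/orP: (y01 i) => /eqP ->; rewrite ?eqxx// eq_sym oner_eq0.
have int01 i : ~~ (0 < x i < 1) -> (x i == 0) || (x i == 1).
  move=> xN; have /andP[x0 x1] := x01 i.
  have [//|xn0 /=] := eqVneq (x i) 0.
  by rewrite eq_le x1/= leNgt; apply: contra xN => ->; rewrite lt_def xn0 x0.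
have [/existsP[i xi]|] := boolP [exists i, 0 < x i < 1]; last first.
  rewrite negb_exists => /forallP xN.
  have [e xe] := done01 x (fun i => int01 i (xN i)).
  exists e; have -> : x = (fun i => (e i)%:R) by exact/funext.
  by rewrite lerDl.
have [/existsP[j /andP[ji xj]]|] := boolP [exists j, (j != i) && (0 < x j < 1)].
  (* With two fractional coordinates, mass flows along [v], whose entries sum to 0. *)
  pose v l : R := (l == i)%:R - (l == j)%:R.
  have vi : v i = 1 by rewrite /v eqxx eq_sym (negbTE ji) subr0.
  have vj : v j = -1 by rewrite /v eqxx (negbTE ji) sub0r.
  have vl l : l != i -> l != j -> v l = 0.
    by move=> /negbTE li /negbTE lj; rewrite /v li lj subr0.
  have v0 : \sum_l v l = 0.
    rewrite (bigD1 i)//= (bigD1 j)//= vi vj addrA subrr add0r.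
    by rewrite big1// => l /andP[]; exact: vl.
  have step t : 0 <= x i + t <= 1 -> 0 <= x j - t <= 1 ->
      [\/ x i + t = 0, x i + t = 1, x j - t = 0 | x j - t = 1] ->
      F x <= F (fun l => x l + t * v l) ->
      exists e : I -> bool,
        \sum_i (e i)%:R <= \sum_i x i + 1 /\ F x <= F (fun i => (e i)%:R).
    move=> ti tj tij Fx.
    have [|l|e [se Fe]] := IH (fun l => x l + t * v l).
    - rewrite -ltnS; apply: leq_trans xn; rewrite ltnS.
      apply: proper_card; apply/properP; split.
        apply/fintype.subsetP => l; rewrite !inE.
        have [->//|li] := eqVneq l i; have [->//|lj] := eqVneq l j.
        by rewrite vl// mulr0 addr0.
      case: tij => tE; [exists i|exists i|exists j|exists j];
        rewrite !inE// ?vi ?vj ?mulr1 ?mulrN1 tE; lra.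
    - have [->|li] := eqVneq l i; first by rewrite vi mulr1.
      have [->|lj] := eqVneq l j; first by rewrite vj mulrN1.
      by rewrite vl// mulr0 addr0.
    - exists e; split; last exact: le_trans Fe.
      by rewrite (le_trans se)// big_split/= -mulr_sumr v0 mulr0 addr0.
  (* [t2] and [t1] are the longest moves along [v] and [- v] that stay in the cube; each makes one
     of the two coordinates integral. *)
  have [t2 [t20 t2i t2j t2E]] : exists t, [/\ 0 <= t, 0 <= x i + t <= 1,
      0 <= x j - t <= 1 &
      [\/ x i + t = 0, x i + t = 1, x j - t = 0 | x j - t = 1]].
    have [h|h] := leP (1 - x i) (x j); [exists (1 - x i)|exists (x j)];
      split; try lra; [apply: Or42|apply: Or43]; lra.
  have [t1 [t10 t1i t1j t1E]] : exists t, [/\ 0 <= t, 0 <= x i + - t <= 1,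
      0 <= x j - - t <= 1 &
      [\/ x i + - t = 0, x i + - t = 1, x j - - t = 0 | x j - - t = 1]].
    have [h|h] := leP (1 - x j) (x i); [exists (1 - x j)|exists (x i)];
      split; try lra; [apply: Or44|apply: Or41]; lra.
  have [Fx|Fx] := Fqc x v t1 t2 t10 t20; first exact: (step t2).
  apply: (step (- t1)) => //.
  by under eq_fun do rewrite mulNr.
(* A single fractional coordinate is left; rounding it to 0 or 1 raises the sum by less than 1. *)
rewrite negb_exists => /forallP xN.
pose v l : R := (l == i)%:R.
have step (t : R) : (t == 0) || (t == 1) ->
    F x <= F (fun l => x l + (t - x i) * v l) ->
      exists e : I -> bool,
        \sum_i (e i)%:R <= \sum_i x i + 1 /\ F x <= F (fun i => (e i)%:R).
  move=> t01 Fx.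
  have [|e xe] := done01 (fun l => x l + (t - x i) * v l).
    move=> l; rewrite /v; have [->|li] := eqVneq l i.
      by rewrite mulr1 addrC subrK.
    by rewrite mulr0 addr0; apply: int01; have := xN l; rewrite li.
  exists e; split.
    under eq_bigr do rewrite -xe.
    rewrite big_split/= -mulr_sumr lerD2l (bigD1 i)//= /v eqxx big1 ?addr0 ?mulr1.
      by case/orP: t01 => /eqP ->; lra.
    by move=> l /negbTE ->.
  suff <- : (fun l => x l + (t - x i) * v l) = (fun i => (e i)%:R) by [].
  exact/funext.
have /andP[xi0 xi1] := xi.
have [] := Fqc x v (x i) (1 - x i).
- exact: ltW.
- by rewrite subr_ge0 ltW.
- by move=> Fx; apply: (step 1) => //; rewrite eqxx orbT.
- move=> Fx; apply: (step 0) => //; first by rewrite eqxx.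
  by rewrite sub0r; under eq_fun do rewrite mulNr.
Qed.

End Rounding.

Section SparseQuadratic.
Context (R : realType).

Lemma quad_le_of_integer_points (n p N : nat) (A : 'I_n -> 'I_p -> R) (D : R) :
  0 <= D ->
  (forall (s : 'I_p -> bool) (r : 'I_p -> nat), (\sum_j r j <= N)%N ->
     \sum_i (\sum_j A i j * ((-1) ^+ s j * (r j)%:R)) ^+ 2
       <= D * \sum_j (r j)%:R ^+ 2) ->
  forall x : 'I_p -> R, \sum_j `|x j| + 1 <= N%:R ->
    \sum_i (\sum_j A i j * x j) ^+ 2 <= D * (\sum_j x j ^+ 2 + \sum_j `|x j|).
Proof.
move=> D0 AD x xN.
(* [|x j|] splits into its integer part [m j] and fractional part [y j]. The point [y] of the cube
   stands for [x], and the vertices stand for integer vectors. *)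
pose s j := x j < 0.
pose m j := Num.truncn `|x j|.
pose y j := `|x j| - (m j)%:R.
have y01 j : 0 <= y j <= 1.
  have /andP[m1 m2] := truncn_itv (normr_ge0 (x j)).
  by rewrite /y subr_ge0 m1/= lerBlDr -natr1 in m2 *; rewrite addrC ltW.
pose B i j := A i j * (-1) ^+ s j.
pose L z i := \sum_j B i j * ((m j)%:R + z j).
(* The second sum interpolates [t ^+ 2] linearly between integers. *)
pose F z := \sum_i L z i ^+ 2
  - D * \sum_j ((m j)%:R ^+ 2 + (2 * (m j)%:R + 1) * z j).
(* On a line [F] is a quadratic with nonnegative leading coefficient, so it does not decrease in the
   direction given by the sign of the linear coefficient. *)
have FE z v t : F (fun j => z j + t * v j) = F z
    + t * (2 * (\sum_i L z i * \sum_j B i j * v j)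
           - D * \sum_j (2 * (m j)%:R + 1) * v j)
    + t ^+ 2 * \sum_i (\sum_j B i j * v j) ^+ 2.
  have LE i : L (fun j => z j + t * v j) i = L z i + t * \sum_j B i j * v j.
    by rewrite /L mulr_sumr -big_split/=; apply: eq_bigr => j _; ring.
  rewrite /F; under eq_bigr do rewrite LE.
  have -> : \sum_j ((m j)%:R ^+ 2 + (2 * (m j)%:R + 1) * (z j + t * v j))
    = \sum_j ((m j)%:R ^+ 2 + (2 * (m j)%:R + 1) * z j)
      + t * \sum_j (2 * (m j)%:R + 1) * v j.
    by rewrite mulr_sumr -big_split/=; apply: eq_bigr => j _; ring.
  have -> : \sum_i (L z i + t * \sum_j B i j * v j) ^+ 2
    = \sum_i L z i ^+ 2 + (2 * t) * (\sum_i L z i * \sum_j B i j * v j)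
      + t ^+ 2 * \sum_i (\sum_j B i j * v j) ^+ 2.
    rewrite !mulr_sumr -!big_split/=; apply: eq_bigr => i _.
    by move: (\sum_j _) => V; ring.
  by ring.
have [|e [se Fe]] := @round_cube R 'I_p F _ y y01.
  move=> z v t1 t2 t10 t20.
  set b := 2 * (\sum_i L z i * \sum_j B i j * v j)
           - D * \sum_j (2 * (m j)%:R + 1) * v j.
  set g := \sum_i (\sum_j B i j * v j) ^+ 2.
  have g0 : 0 <= g by apply: sumr_ge0 => i _; exact: sqr_ge0.
  have [b0|/ltW b0] := leP 0 b; [left|right].
    by rewrite FE -/b -/g -addrA lerDl addr_ge0 ?mulr_ge0 ?sqr_ge0.
  under [X in _ <= F X]eq_fun do rewrite -mulNr.
  rewrite FE -/b -/g -addrA lerDl addr_ge0//.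
    by rewrite mulNr -mulrN mulr_ge0// oppr_ge0.
  by rewrite mulr_ge0 ?sqr_ge0.
pose r j := (m j + e j)%N.
(* The increase by at most 1 in [round_cube] is paid for by the [+ 1] in [xN]. *)
have rN : (\sum_j r j <= N)%N.
  rewrite -(ler_nat R) (le_trans _ xN)// natr_sum.
  under eq_bigr do rewrite natrD.
  rewrite big_split/= (le_trans (lerD (lexx _) se))// addrA -big_split/=.
  by rewrite lerD2r; apply: ler_sum => j _; rewrite /y addrC subrK.
(* At a vertex the interpolation is exact: m^2 + (2 m + 1) e = (m + e)^2 for e in {0, 1}. Hence [AD]
   applies. *)
have Fe0 : F (fun j => (e j)%:R) <= 0.
  rewrite /F subr_le0.
  have -> : \sum_j ((m j)%:R ^+ 2 + (2 * (m j)%:R + 1) * (e j)%:R)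
      = \sum_j (r j)%:R ^+ 2 :> R.
    by apply: eq_bigr => j _; rewrite /r natrD; case: (e j) => /=; ring.
  have -> : \sum_i L (fun j => (e j)%:R) i ^+ 2
      = \sum_i (\sum_j A i j * ((-1) ^+ s j * (r j)%:R)) ^+ 2.
    by apply: eq_bigr => i _; congr (_ ^+ 2); apply: eq_bigr => j _;
      rewrite /B /r natrD mulrA.
  exact: AD.
have := le_trans Fe Fe0; rewrite /F subr_le0.
have -> : \sum_i L y i ^+ 2 = \sum_i (\sum_j A i j * x j) ^+ 2.
  apply: eq_bigr => i _; congr (_ ^+ 2); apply: eq_bigr => j _.
  by rewrite /B /y addrC subrK -mulrA -numEsign.
(* Termwise, (M + Y)^2 + (M + Y) exceeds M^2 + (2 M + 1) Y by Y^2 + M. *)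
move=> /le_trans; apply; rewrite ler_wpM2l// -big_split/=.
apply: ler_sum => j _; rewrite -[x j ^+ 2]real_normK ?num_real//.
have : 0 <= (m j)%:R :> R by [].
have /andP[yj _] := y01 j; move: yj.
have -> : `|x j| = (m j)%:R + y j by rewrite /y addrC subrK.
by move: (m j)%:R (y j) => M Y; nra.
Qed.

(* A list of signed unit vectors, with [None] for [0], encodes their sum; an
   integer vector of l1-norm at most [N] is then one of [(2 p + 1) ^ N] tuples. *)
Definition signed_count (p : nat) (t : seq (option ('I_p * bool))) (j : 'I_p) :
    R :=
  \sum_(o <- t) (if o is Some (i, b) then (-1) ^+ (b : bool) *+ (i == j) else 0).

(** Take [r j] copies of [Some (j, s j)] for each [j] and pad with [None] up to length [N]. *)
Lemma signed_count_onto (p N : nat) (s : 'I_p -> bool) (r : 'I_p -> nat) :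
  (\sum_j r j <= N)%N ->
  exists t : N.-tuple (option ('I_p * bool)),
    forall j, signed_count t j = (-1) ^+ s j * (r j)%:R.
Proof.
move=> rN.
pose t0 := flatten [seq nseq (r j) (Some (j, s j)) | j <- enum 'I_p].
pose t := t0 ++ nseq (N - \sum_j r j) None.
have tN : size t == N.
  rewrite size_cat size_nseq size_flatten /shape -map_comp sumnE big_map.
  rewrite big_enum/= (eq_bigr r) ?subnKC// => j _; exact: size_nseq.
exists (Tuple tN) => j; rewrite /signed_count/= big_cat/= [X in _ + X]big1_seq.
  rewrite addr0 big_flatten/= big_map big_enum/= (bigD1 j)//=.
  rewrite big_nseq iter_addr_0 eqxx mulr1n mulr_natr.
  rewrite big1 ?addr0// => i ij.
  by rewrite big_nseq (negbTE ij) mulr0n iter_addr_0 mul0rn.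
by move=> o; rewrite mem_nseq => /andP[_ /andP[_ /eqP ->]].
Qed.

End SparseQuadratic.

(** * The spiked model *)

Section Model.
Context (R : realType) (d : measure_display) (T : measurableType d).
Context (P : probability T R).

(** Markov's inequality for the sum of all the exponentials, which dominates each of them; a single
    measurable event thus covers every deviation. *)
Lemma exp_moment_union_bound (K : finType) (h : K -> T -> R) (C s : R) :
  (forall k, measurable_fun setT (h k)) ->
  (forall k, (\int[P]_w (expR (h k w))%:E <= C%:E)%E) ->
  exists B, [/\ measurable B, (P B <= (expR (- s) * (#|K|%:R * C))%:E)%E &
    forall w k, s < h k w -> B w].
Proof.
move=> mh hC; pose Z w := \sum_k expR (h k w).
have mZ : measurable_fun setT Z.
  by apply: measurable_sum => k; exact: measurableT_comp.
have Z0 w : 0 <= Z w by apply: sumr_ge0 => k _; exact: expR_ge0.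
exists [set w | expR s <= Z w].
have mB : measurable [set w | expR s <= Z w].
  rewrite (_ : [set w | _] = Z @^-1` `[expR s, +oo[).
    by rewrite -[_ @^-1` _]setTI; exact: mZ.
  by apply/seteqP; split => w /=; rewrite in_itv/= andbT.
split => //.
  rewrite -[X in P X]setIT -integral_indic//.
  apply: (@le_trans _ _ (\int[P]_w ((expR (- s))%:E * (Z w)%:E))%E).
    apply: ge0_le_integral => //.
    - exact/measurable_EFinP/measurable_indic.
    - by apply/measurable_EFinP; exact: measurable_funM.
    - move=> w _; rewrite -EFinM lee_fin indicE.
      case: (boolP (w \in _)) => [|_]; last by rewrite mulr_ge0 ?expR_ge0.
      by rewrite inE/= expRN mulrC ler_pdivlMr ?expR_gt0// mul1r.
  rewrite ge0_integralZl//; last 2 first.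
  - exact/measurable_EFinP.
  - by move=> w _; rewrite lee_fin.
  rewrite EFinM lee_wpmul2l// ?lee_fin ?expR_ge0//.
  under eq_integral do rewrite /Z -sumEFin.
  rewrite ge0_integral_sum//; last first.
    by move=> k; exact/measurable_EFinP/measurableT_comp.
  apply: (@le_trans _ _ (\sum_(k : K) C%:E)%E); first exact: lee_sum.
  by rewrite sumEFin lee_fin sumr_const mulr_natl lexx.
move=> w k shk /=; rewrite /Z (bigD1 k)//= (@le_trans _ _ (expR (h k w)))//.
  by rewrite ler_expR ltW.
by rewrite lerDl sumr_ge0// => j _; exact: expR_ge0.
Qed.

Context (n p : nat) (beta : R) (z : 'cV[R]_p).
Context (u : 'I_n -> {RV P >-> R}) (xi : 'I_n -> 'I_p -> {RV P >-> R}).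
Hypothesis model : gaussian_model u xi.
Hypothesis beta0 : 0 <= beta.
Hypothesis z1 : \sum_j z j ord0 ^+ 2 = 1.

Let x w i j := sample beta z u xi w i j ord0.

Lemma sampleE w i j : x w i j = Num.sqrt beta * u i w * z j ord0 + xi i j w.
Proof. by rewrite /x /sample !mxE. Qed.

Lemma measurable_sample i j : measurable_fun setT (fun w => x w i j).
Proof.
under eq_fun do rewrite sampleE.
by apply: measurable_funD => //; apply: measurable_funM => //;
  exact: measurable_funM.
Qed.

Lemma measurable_sample_dot (a : 'I_p -> R) i :
  measurable_fun setT (fun w => \sum_j x w i j * a j).
Proof.
apply: measurable_sum => j; apply: measurable_funM => //.
exact: measurable_sample.
Qed.

(** Cauchy-Schwarz, from |a - t z|^2 >= 0 at t = <z, a>. *)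
Lemma sqr_dot_unit_le (a : 'I_p -> R) :
  (\sum_j z j ord0 * a j) ^+ 2 <= \sum_j a j ^+ 2.
Proof.
have E t : \sum_j (a j - t * z j ord0) ^+ 2
    = \sum_j a j ^+ 2 - 2 * t * \sum_j z j ord0 * a j
      + t ^+ 2 * \sum_j z j ord0 ^+ 2.
  rewrite !mulr_sumr -sumrB -big_split/=.
  by apply: eq_bigr => j _; ring.
have := E (\sum_j z j ord0 * a j); rewrite z1.
set t := \sum_j z j ord0 * a j; set q := \sum_j (_ - _) ^+ 2 => qE.
have : 0 <= q by apply: sumr_ge0 => j _; exact: sqr_ge0.
by rewrite qE; lra.
Qed.

(** An upper bound for the variance |a|^2 + beta <z, a>^2 of <x_i, a>. *)
Let var (a : 'I_p -> R) := (1 + beta) * \sum_j a j ^+ 2.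

(** The exponent is one linear form in the independent normals [model_vars], so its exponential
    moment is explicit; its variance is at most |c|^2 by Cauchy-Schwarz. *)
Lemma sample_dot_subgaussian (a : 'I_p -> R) (c : 'I_n -> R) :
  (\int[P]_w (expR (\sum_i c i *
     ((\sum_j x w i j * a j) / Num.sqrt (var a))))%:E
   <= (expR ((\sum_i c i ^+ 2) / 2))%:E)%E.
Proof.
pose q := (Num.sqrt (var a))^-1; pose t := \sum_j z j ord0 * a j.
pose b (s : 'I_n + 'I_n * 'I_p) := match s with
  | inl i => c i * q * (Num.sqrt beta * t)
  | inr ij => c ij.1 * q * a ij.2 end.
have a0 : 0 <= \sum_j a j ^+ 2 by apply: sumr_ge0 => j _; exact: sqr_ge0.
have bE w : \sum_i c i * ((\sum_j x w i j * a j) / Num.sqrt (var a))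
    = \sum_s b s * model_vars u xi s w.
  rewrite big_sumType/= -(pair_bigA _ (fun i j => c i * q * a j * xi i j w))/=.
  rewrite -big_split/=; apply: eq_bigr => i _.
  under eq_bigr do rewrite sampleE mulrDl.
  rewrite big_split/= mulrDl mulrDr; congr (_ + _).
    rewrite /t /q mulr_suml mulr_sumr !mulr_sumr mulr_suml.
    by apply: eq_bigr => j _; ring.
  by rewrite mulr_suml mulr_sumr; apply: eq_bigr => j _; rewrite /q; ring.
under eq_integral do rewrite bE.
have [nu nxi ind] := model.
rewrite integral_expR_indep_normal//;
  last by case=> [i|[i j]]; [exact: nu|exact: nxi].
rewrite lee_fin ler_expR ler_pM2r ?invr_gt0//.
rewrite big_sumType/= -(pair_bigA _ (fun i j => (c i * q * a j) ^+ 2))/=.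
rewrite -big_split/=; apply: ler_sum => i _.
under eq_bigr do rewrite exprMn.
rewrite -mulr_sumr exprMn -mulrDr exprMn -mulrA ler_piMr ?sqr_ge0//.
rewrite exprMn sqr_sqrtr// /q exprVn sqr_sqrtr ?mulr_ge0 ?addr_ge0//.
have [v0|v0] := eqVneq (var a) 0; first by rewrite v0 invr0 mul0r.
have vgt0 : 0 < var a by rewrite lt_def v0 mulr_ge0 ?addr_ge0.
rewrite mulrC ler_pdivrMr// mul1r /var mulrDl mul1r addrC lerD2l.
by rewrite ler_wpM2l// sqr_dot_unit_le.
Qed.

Lemma sample_tail (N : nat) (s : R) :
  exists B, [/\ measurable B,
    (P B <= (expR (- (s / 4)) *
       ((p * 2).+1%:R ^+ N * Num.sqrt 2 ^+ n))%:E)%E &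
    forall w, ~ B w -> forall t : N.-tuple (option ('I_p * bool)),
      \sum_i (\sum_j x w i j * signed_count R t j) ^+ 2
        <= (1 + beta) * s * \sum_j signed_count R t j ^+ 2].
Proof.
pose h (t : N.-tuple (option ('I_p * bool))) w :=
  (\sum_i ((\sum_j x w i j * signed_count R t j)
     / Num.sqrt (var (signed_count R t))) ^+ 2) / 4.
have [|t|B [mB PB hB]] := @exp_moment_union_bound _ h (Num.sqrt 2 ^+ n) (s / 4).
- move=> t; apply: measurable_funM => //; apply: measurable_sum => i.
  apply: measurable_funX; apply: measurable_funM => //.
  exact: measurable_sample_dot.
- rewrite /h -[n in X in (_ <= X)%E]card_ord.
  apply: integral_expR_sqr_subgaussian => [i|c].
    by apply: measurable_funM => //; exact: measurable_sample_dot.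
  exact: sample_dot_subgaussian.
exists B; split => //.
  by rewrite card_tuple card_option card_prod card_ord card_bool natrX in PB.
move=> w nBw t; set a := signed_count R t.
have a0 : 0 <= \sum_j a j ^+ 2 by apply: sumr_ge0 => j _; exact: sqr_ge0.
have v0 : 0 <= var a by rewrite mulr_ge0 ?addr_ge0.
have : h t w <= s / 4 by rewrite leNgt; apply/negP => /hB.
rewrite /h -/a ler_pM2r ?invr_gt0//.
under eq_bigr do rewrite expr_div_n sqr_sqrtr//.
rewrite -mulr_suml mulrAC -/(var a).
(* For [a = 0] the normalized bound divides by zero, but both sides of the goal vanish. *)
have [a2|an0] := eqVneq (\sum_j a j ^+ 2) 0.
  have a00 j : a j = 0.
    apply/eqP; rewrite -sqrf_eq0; apply/eqP.
    by apply: (psumr_eq0P _ a2) => // l _; exact: sqr_ge0.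
  move=> _; rewrite /var a2 mulr0 mul0r big1// => i _.
  by rewrite big1 ?expr0n// => j _; rewrite a00 mulr0.
have v1 : 0 < var a.
  by rewrite mulr_gt0//; [rewrite ltr_pwDl|rewrite lt_def an0].
by rewrite ler_pdivrMr// mulrC.
Qed.

End Model.

(** * Measurability of the uniform bound *)

Section Measurability.
Context (R : realType) (p : nat).
Implicit Types S Y : 'M[R]_p.

Definition mxdist S S' : R := \sum_i \sum_j `|S i j - S' i j|.

Lemma mxdistC S S' : mxdist S S' = mxdist S' S.
Proof. by do 2 (apply: eq_bigr => ? _); rewrite distrC. Qed.

Lemma mxdist_triangle S1 S2 S3 :
  mxdist S1 S3 <= mxdist S1 S2 + mxdist S2 S3.
Proof.
rewrite -big_split/=; apply: ler_sum => i _.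
rewrite -big_split/=; apply: ler_sum => j _; exact: ler_distD.
Qed.

(** Each entry of [Y] is at most [mxnormS Y] in modulus. *)
Lemma mxdot_lipschitz S S' Y :
  mxdot S Y <= mxdot S' Y + mxdist S S' * mxnormS Y.
Proof.
rewrite /mxdist mulr_suml -big_split/=; apply: ler_sum => i _.
rewrite mulr_suml -big_split/=; apply: ler_sum => j _.
rewrite -lerBlDl -mulrBl (le_trans (ler_norm _))// normrM ler_wpM2l//.
rewrite /mxnormS (bigD1 i)//= (bigD1 j)//= -addrA lerDl addr_ge0//.
  exact: sumr_ge0.
by apply: sumr_ge0 => l _; exact: sumr_ge0.
Qed.

Lemma mxdist_rat_dense S (e : R) : 0 < e ->
  exists q : 'M[rat]_p, mxdist S (map_mx ratr q) < e.
Proof.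
(* The [p * p] entrywise errors are at most [h] each; the successor makes their sum strictly less
   than [e] and covers [p = 0]. *)
move=> e0; pose h := e / (p * p).+1%:R.
have h0 : 0 < h by rewrite divr_gt0.
have /choice[f fP] : forall ij : 'I_p * 'I_p, exists q : rat,
    `|S ij.1 ij.2 - ratr q| <= h.
  move=> ij; have [|q] := @rat_in_itvoo R (S ij.1 ij.2 - h) (S ij.1 ij.2 + h).
    by lra.
  by rewrite in_itv/= => /andP[q1 q2]; exists q; rewrite ler_norml; lra.
exists (\matrix_(i, j) f (i, j)).
apply: (@le_lt_trans _ _ (\sum_(i < p) \sum_(j < p) h)).
  apply: ler_sum => i _; apply: ler_sum => j _; rewrite !mxE.
  exact: (fP (i, j)).
rewrite !sumr_const !card_ord -mulrnA -mulr_natr /h mulrAC ltr_pdivrMr//.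
by rewrite ltr_pM2l// ltr_nat.
Qed.

Context (d : measure_display) (T : measurableType d).

(* The set of matrices violating one of the inequalities is open, hence a
   countable union of balls with rational centre and radius [1 / m.+1]. *)
Lemma measurable_forall_mxdot_le (G : T -> 'M[R]_p) (K : set 'M[R]_p) (t : R) :
  (forall i j, measurable_fun setT (fun w => G w i j)) ->
  measurable [set w | forall Y, K Y -> mxdot (G w) Y <= t].
Proof.
move=> mG.
pose ball (qm : 'M[rat]_p * nat) S :=
  mxdist S (map_mx ratr qm.1) < qm.2.+1%:R^-1.
pose good qm := forall S, ball qm S -> exists2 Y, K Y & t < mxdot S Y.
rewrite -[X in measurable X]setCK; apply: measurableC.
rewrite (_ : ~` _ = \bigcup_qm [set w | good qm /\ ball qm (G w)]); last first.
  apply/seteqP; split => [w /=|w [qm _ /= [gqm /gqm[Y KY tY]]]]; last first.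
    by move=> /(_ _ KY); rewrite leNgt tY.
  move=> /existsNP[Y /not_implyP[KY /negP]]; rewrite -ltNge => tY.
  pose M := mxnormS Y.
  have M0 : 0 <= M by apply: sumr_ge0 => i _; exact: sumr_ge0.
  pose e := mxdot (G w) Y - t.
  have e0 : 0 < e by rewrite subr_gt0.
  (* Points of a ball of radius 1 / (m + 1) are less than 2 / (m + 1) apart, which moves the pairing
     with [Y] by at most 2 M / (m + 1) < e. *)
  pose m := Num.truncn (2 * (M + 1) / e).
  have mE : 2 * m.+1%:R^-1 * M < e.
    have := truncnS_gt (2 * (M + 1) / e); rewrite -/m ltr_pdivrMr// => h.
    by rewrite mulrAC ltr_pdivrMr// [e * _]mulrC; lra.
  have [q qS] := @mxdist_rat_dense (G w) m.+1%:R^-1 ltac:(by rewrite invr_gt0).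
  exists (q, m) => //=; split; last exact: qS.
  move=> S; rewrite /ball/= => Sq; exists Y => //.
  have := mxdot_lipschitz (G w) S Y; rewrite -/M.
  have : mxdist (G w) S * M <= 2 * m.+1%:R^-1 * M.
    rewrite ler_wpM2r//; have := mxdist_triangle (G w) (map_mx ratr q) S.
    move=> /le_trans; apply.
    by rewrite (mxdistC (map_mx _ _) S) mulr_natl mulr2n lerD// ltW.
  by move: mE; rewrite /e; move: (2 / _ * M) => h; lra.
apply: countable_bigcupT_measurable => [|qm]; first exact: countableP.
have [gqm|ngqm] := pselect (good qm); last first.
  by rewrite (_ : [set _ | _] = set0)//; apply/seteqP; split => // w [].
rewrite (_ : [set _ | _]
    = (fun w => mxdist (G w) (map_mx ratr qm.1)) @^-1` `]-oo, qm.2.+1%:R^-1[).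
  rewrite -[_ @^-1` _]setTI.
  have mdist : measurable_fun setT (fun w => mxdist (G w) (map_mx ratr qm.1)).
    apply: measurable_sum => i; apply: measurable_sum => j.
    by apply: measurableT_comp => //; exact: measurable_funB.
  exact: mdist.
by apply/seteqP; split => w /=; rewrite in_itv/=; [case|split].
Qed.

End Measurability.

(** * Feasible rank-one matrices *)

Section Feasible.
Context (R : realType) (n p : nat).

Lemma mxdot_sample_cov (x : 'I_n -> 'cV[R]_p) (y : 'cV[R]_p) :
  mxdot (sample_cov x) (y *m y^T)
  = n%:R^-1 * \sum_i (\sum_j x i j ord0 * y j ord0) ^+ 2.
Proof.
transitivity (\sum_(i < p) \sum_(j < p) \sum_(l < n)
    n%:R^-1 * ((x l i ord0 * y i ord0) * (x l j ord0 * y j ord0))).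
  apply: eq_bigr => i _; apply: eq_bigr => j _.
  rewrite !mxE summxE big_ord1 !mxE -mulrA mulr_suml mulr_sumr.
  by apply: eq_bigr => l _; rewrite !mxE big_ord1 !mxE; ring.
under eq_bigr do rewrite exchange_big.
rewrite exchange_big mulr_sumr; apply: eq_bigr => l _ /=.
rewrite expr2 mulr_suml mulr_sumr; apply: eq_bigr => i _.
by rewrite mulr_sumr mulr_sumr.
Qed.

Lemma feasible_quad_le (k : nat) (x : 'I_n -> 'cV[R]_p) (D : R)
    (y : 'cV[R]_p) :
  (0 < k)%N -> 0 <= D -> sdp_feasible k (y *m y^T) ->
  (forall t : k.+1.-tuple (option ('I_p * bool)),
     \sum_i (\sum_j x i j ord0 * signed_count R t j) ^+ 2
       <= D * \sum_j signed_count R t j ^+ 2) ->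
  \sum_i (\sum_j x i j ord0 * y j ord0) ^+ 2 <= 2 * D.
Proof.
move=> k0 D0 [_ ytr yS] xD.
have y2 : \sum_j y j ord0 ^+ 2 = 1.
  by rewrite -ytr; apply: eq_bigr => j _; rewrite mxE big_ord1 !mxE.
have kR : 0 < k%:R :> R by rewrite ltr0n.
(* The entrywise l1 norm of [y *m y^T] is the square of the l1 norm of [y]. *)
have y1 : (\sum_j `|y j ord0|) ^+ 2 <= k%:R.
  rewrite (le_trans _ yS)// expr2 mulr_suml; apply: ler_sum => i _.
  rewrite mulr_sumr; apply: ler_sum => j _.
  by rewrite mxE big_ord1 !mxE normrM.
pose a := Num.sqrt (k%:R : R).
have a0 : 0 <= a by exact: sqrtr_ge0.
have a2 : a ^+ 2 = k%:R by rewrite sqr_sqrtr// ltW.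
have y1a : \sum_j `|y j ord0| <= a.
  by rewrite -[leLHS]ger0_norm ?sumr_ge0// -sqrtr_sqr ler_wsqrtr.
have ay : \sum_j `|a * y j ord0| <= k%:R.
  under eq_bigr do rewrite normrM (ger0_norm a0).
  by rewrite -mulr_sumr -a2 expr2 ler_wpM2l.
have := @quad_le_of_integer_points R n p k.+1 (fun i j => x i j ord0) D D0 _
  (fun j => a * y j ord0).
have -> : \sum_i (\sum_j x i j ord0 * (a * y j ord0)) ^+ 2
    = k%:R * \sum_i (\sum_j x i j ord0 * y j ord0) ^+ 2.
  rewrite mulr_sumr; apply: eq_bigr => i _; rewrite -a2 -exprMn mulr_sumr.
  by congr (_ ^+ 2); apply: eq_bigr => j _; ring.
have -> : \sum_j (a * y j ord0) ^+ 2 = k%:R.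
  by under eq_bigr do rewrite exprMn a2; rewrite -mulr_sumr y2 mulr1.
move=> H; rewrite -(ler_pM2l kR); apply: le_trans (H _ _) _.
- move=> s r rN; have [t tE] := @signed_count_onto R p k.+1 s r rN.
  have := xD t; under eq_bigr do under eq_bigr do rewrite tE.
  under [X in _ <= _ * X]eq_bigr do rewrite tE exprMn sqrr_sign mul1r.
  by [].
- by rewrite -natr1 lerD2r.
- have := ler_wpM2l D0 ay; nra.
Qed.

End Feasible.

(** * The bound at a fixed sample size *)

Section SingleSample.
Context (R : realType).

(** From exp(1 / 16) >= 17 / 16 follows exp(3 / 8) >= (17 / 16)^6, and (17 / 16)^12 > 2. *)
Lemma sqrt2_expRN_lt1 : Num.sqrt 2 * expR (- (3 / 8)) < 1 :> R.
Proof.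
have s0 : 0 <= Num.sqrt 2 :> R := sqrtr_ge0 _.
have e16 : 17 / 16 <= expR (1 / 16) :> R.
  by apply: le_trans (expR_ge1Dx _); lra.
have e38 : expR (3 / 8) = expR (1 / 16) ^+ 6 :> R.
  by rewrite -expRM_natl; congr expR; lra.
rewrite expRN ltr_pdivrMr ?expR_gt0// mul1r e38.
apply: (@lt_le_trans _ _ ((17 / 16) ^+ 6)); last first.
  by apply: lerXn2r => //; rewrite nnegrE ?expR_ge0//; lra.
have q0 : 0 <= 17 / 16 :> R by lra.
by rewrite -ltr_sqr ?nnegrE ?exprn_ge0// sqr_sqrtr//; lra.
Qed.

(** The event is an intersection over uncountably many [y]; its measurability is what allows
    comparing its probability with that of another event and with 1. *)
Lemma measurable_sdp_bound (d : measure_display) (T : measurableType d)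
    (P : probability T R) (n p k : nat) (beta b : R) (z : 'cV[R]_p)
    (u : 'I_n -> {RV P >-> R}) (xi : 'I_n -> 'I_p -> {RV P >-> R}) :
  measurable [set w : T | forall y : 'cV[R]_p, sdp_feasible k (y *m y^T) ->
    mxdot (sample_cov (sample beta z u xi w)) (y *m y^T) <= b].
Proof.
rewrite (_ : [set w | _] = [set w | forall Y, [set Y | exists2 y : 'cV[R]_p,
    sdp_feasible k (y *m y^T) & Y = y *m y^T] Y ->
    mxdot (sample_cov (sample beta z u xi w)) Y <= b]).
  apply: measurable_forall_mxdot_le => i j.
  rewrite (_ : (fun w => _) = (fun w => n%:R^-1 * \sum_l
    sample beta z u xi w l i ord0 * sample beta z u xi w l j ord0)).
    apply: measurable_funM => //; apply: measurable_sum => l.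
    by apply: measurable_funM; exact: measurable_sample.
  apply/funext => w; rewrite mxE summxE; congr (_ * _).
  by apply: eq_bigr => l _; rewrite mxE big_ord1 !mxE.
apply/seteqP; split => w /= Hw.
  by move=> Y [y fy ->]; exact: Hw.
by move=> y fy; apply: Hw; exists y.
Qed.

Lemma gaussian_spike_sdp_bound (d : measure_display) (T : measurableType d)
    (P : probability T R) (n p k : nat) (beta : R) (z : 'cV[R]_p)
    (u : 'I_n -> {RV P >-> R}) (xi : 'I_n -> 'I_p -> {RV P >-> R}) :
  gaussian_model u xi -> \sum_j z j ord0 ^+ 2 = 1 ->
  (0 < n)%N -> (0 < k)%N -> 0 <= beta <= Num.sqrt (p%:R / n%:R) ->
  20 < p%:R / n%:R :> R ->
  8 * (ln (p * 2).+1%:R * k.+1%:R) <= n%:R / 5 :> R ->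
  ((1 - (Num.sqrt 2 * expR (- (3 / 8))) ^+ n)%:E <=
   P [set w : T | forall y : 'cV[R]_p, sdp_feasible k (y *m y^T) ->
        (mxdot (sample_cov (sample beta z u xi w)) (y *m y^T)
          <= 8 / 9 * (p%:R / n%:R))%R])%E.
Proof.
move=> model z1 n0 k0 /andP[beta0 betar] r20 logk.
set Good := [set w | _].
pose Lk : R := ln (p * 2).+1%:R * k.+1%:R.
(* Here s / 4 = 3 n / 8 + Lk. As exp(Lk) is the number of tuples, the second term cancels the union
   bound and exp(- 3 n / 8) remains. *)
pose s : R := 3 / 2 * n%:R + 4 * Lk.
have [B [mB PB hB]] := sample_tail model beta0 z1 k.+1 s.
have nR : 0 < n%:R :> R by rewrite ltr0n.
have Lk0 : 0 <= Lk by rewrite mulr_ge0// ln_ge0// ler1n.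
have s0 : 0 <= s by rewrite /s; lra.
have mGood : measurable Good by exact: measurable_sdp_bound.
apply: (@le_trans _ _ (P (~` B))); last first.
  apply: le_measure; rewrite ?inE//; first exact: measurableC.
  move=> w nBw y fy; rewrite mxdot_sample_cov.
  have D0 : 0 <= (1 + beta) * s by rewrite mulr_ge0// addr_ge0.
  have Q := feasible_quad_le k0 D0 fy (hB w nBw).
  rewrite mulrC ler_pdivrMr// (le_trans Q)//.
  pose q := Num.sqrt (p%:R / n%:R : R).
  have q2 : q ^+ 2 = p%:R / n%:R by rewrite sqr_sqrtr// divr_ge0.
  have q0 : 0 <= q by exact: sqrtr_ge0.
  rewrite -q2 in r20 *.
  (* 2 s = 3 n + 8 Lk, and 8 Lk <= n / 5 by hypothesis. *)
  have sn : 2 * s <= 16 / 5 * n%:R.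
    have : 8 * Lk <= n%:R / 5 by [].
    by rewrite /s; move: (Lk) (n%:R : R) => a b; lra.
  (* The positive root of the difference, about 4.42, lies just below sqrt 20. *)
  have qE : (1 + q) * (16 / 5) <= 8 / 9 * q ^+ 2 by nra.
  rewrite mulrCA (@le_trans _ _ ((1 + q) * (16 / 5 * n%:R)))//.
    apply: ler_pM => //; [lra| |by rewrite lerD2l].
    by rewrite mulr_ge0.
  by rewrite mulrA ler_wpM2r// ltW.
rewrite probability_setC// EFinB leeB// (le_trans PB)// lee_fin.
rewrite exprMn mulrA mulrC ler_wpM2l ?exprn_ge0 ?sqrtr_ge0//.
rewrite -[(p * 2).+1%:R]lnK ?posrE// -!expRM_natl.
rewrite -(expRD (- (s / 4))) ler_expR /s /Lk.
by move: (ln _) => l; lra.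
Qed.
End SingleSample.

(** * Asymptotics *)

Section Asymptotics.
Context (R : realType).

(** The threshold e + 2 ensures both p >= e and 2 p + 1 <= p^2. *)
Lemma ln_double_succ_le (p : nat) : expR 1 + 2 <= p%:R :> R ->
  1 <= ln (p%:R : R) /\ ln ((p * 2).+1%:R : R) <= 2 * ln (p%:R : R).
Proof.
move=> pe; have e1 : 2 <= expR 1 :> R by apply: le_trans (expR_ge1Dx _); lra.
have p0 : 0 < p%:R :> R by lra.
split; first by rewrite -[leLHS]expRK ler_ln ?posrE ?expR_gt0//; lra.
rewrite mulr_natl -lnXn// ler_ln ?posrE ?exprn_gt0//.
by rewrite -natr1 natrM; nra.
Qed.

(** By the last hypothesis k ln^2 p is small against p, hence against n; one logarithm is dropped
    because ln p >= 1 eventually. *)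
Lemma near_log_sparsity_le (p k : nat -> nat) (c e : R) :
  0 < e -> p @ \oo --> \oo -> k @ \oo --> \oo ->
  (p n)%:R / n%:R @[n --> \oo] --> c ->
  (k n)%:R / ((p n)%:R / ln (p n)%:R ^+ 2) @[n --> \oo] --> (0 : R) ->
  \forall n \near \oo, ln (p n * 2).+1%:R * (k n).+1%:R <= e * n%:R.
Proof.
move=> e0 p_infty k_infty pn kp.
have c1 : 0 < `|c| + 1 by rewrite ltr_wpDl.
(* The 4 absorbs ln(2 p + 1) <= 2 ln p and k + 1 <= 2 k; [|c| + 1] eventually bounds p / n. *)
have h0 : 0 < e / (4 * (`|c| + 1)) by rewrite divr_gt0// mulr_gt0.
near=> n.
have k0 : 1 <= (k n)%:R :> R.
  by rewrite ler1n; near: n; exact: (k_infty _ (nbhs_infty_ge 1)).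
have pe : expR 1 + 2 <= (p n)%:R :> R.
  apply: (@le_trans _ _ (Num.truncn (expR 1 + 2 : R)).+1%:R).
    by apply/ltW/truncnS_gt.
  by rewrite ler_nat; near: n; exact: (p_infty _ (nbhs_infty_ge _)).
have n0 : 0 < n%:R :> R by rewrite ltr0n; near: n; exact: nbhs_infty_gt.
have [ln1 ln2] := ln_double_succ_le pe.
have p0 : 0 < (p n)%:R :> R.
  by apply: lt_le_trans pe; rewrite ltr_wpDl// expR_ge0.
have pc : (p n)%:R <= (`|c| + 1) * n%:R :> R.
  rewrite -ler_pdivrMr// ltW//; near: n; apply: (cvgr_lt _ pn).
  by rewrite (le_lt_trans (ler_norm c))// ltrDl.
have : (k n)%:R / ((p n)%:R / ln (p n)%:R ^+ 2) < e / (4 * (`|c| + 1)) :> R.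
  by near: n; exact: (cvgr_lt _ kp).
have l0 : 0 < ln (p n)%:R :> R by lra.
rewrite ltr_pdivrMr ?divr_gt0 ?exprn_gt0// mulrA ltr_pdivlMr ?exprn_gt0//.
move=> kl.
have kl' : (k n)%:R * ln (p n)%:R ^+ 2 <= e / 4 * n%:R :> R.
  apply: (le_trans (ltW kl)).
  apply: (@le_trans _ _ (e / (4 * (`|c| + 1)) * ((`|c| + 1) * n%:R))).
    by rewrite ler_wpM2l// ltW.
  by rewrite le_eqVlt; apply/orP; left; apply/eqP; field; lra.
apply: (@le_trans _ _ ((2 * ln (p n)%:R) * (2 * (k n)%:R))).
  by apply: ler_pM => //; [rewrite ln_ge0// ler1n|rewrite -natr1; lra].
have : (k n)%:R * ln (p n)%:R <= (k n)%:R * ln (p n)%:R ^+ 2 :> R.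
  by rewrite ler_wpM2l// expr2 ler_peMr// ltW.
by move: kl'; move: (ln (p n)%:R) (k n)%:R => a b; lra.
Unshelve. all: by end_near. Qed.

End Asymptotics.

Theorem theorem1p5 (R : realType)
  (p k : nat -> nat) (c : R) (beta : nat -> R)
  (z : forall n : nat, 'cV[R]_(p n))
  (d : nat -> measure_display) (T : forall n : nat, measurableType (d n))
  (P : forall n : nat, probability (T n) R)
  (u : forall n : nat, 'I_n -> {RV (P n) >-> R})
  (xi : forall n : nat, 'I_n -> 'I_(p n) -> {RV (P n) >-> R})
  (model : forall n : nat, gaussian_model (@u n) (@xi n))
  (spike : \forall n \near \oo, is_spike (k n) (z n))
  (c_gt20 : 20 < c)
  (p_infty : p @ \oo --> \oo)
  (k_infty : k @ \oo --> \oo)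
  (p_over_n : (p n)%:R / n%:R @[n --> \oo] --> c)
  (beta_gt0 : forall n : nat, 0 < beta n)
  (beta_le : \forall n \near \oo, beta n <= Num.sqrt ((p n)%:R / n%:R))
  (k_ge : \forall n \near \oo, 2 * (p n)%:R / Num.sqrt n%:R <= (k n)%:R :> R)
  (k_over_p : (k n)%:R / (p n)%:R @[n --> \oo] --> (0 : R))
  (k_small : (k n)%:R / ((p n)%:R / ln (p n)%:R ^+ 2) @[n --> \oo] --> (0 : R)) :
  P n [set w : T n | forall y : 'cV[R]_(p n),
         sdp_feasible (k n) (y *m y^T) ->
         mxdot (sample_cov (sample (beta n) (z n) (@u n) (@xi n) w)) (y *m y^T)
           <= 8 / 9 * ((p n)%:R / n%:R)] @[n --> \oo] --> 1%E.
Proof.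
(* The probability is squeezed between [1 - rho ^+ n] and 1. *)
pose rho : R := Num.sqrt 2 * expR (- (3 / 8)).
have rho0 : 0 <= rho by rewrite mulr_ge0 ?sqrtr_ge0 ?expR_ge0.
have rho1 : rho < 1 by exact: sqrt2_expRN_lt1.
pose f n := (1 - rho ^+ n)%:E.
have cf : f @ \oo --> 1%E.
  apply: cvg_EFin; first exact: nearW.
  rewrite -[X in _ --> X]subr0; apply: cvgB; first exact: cvg_cst.
  by apply: cvg_expr; rewrite ger0_norm.
apply: squeeze_cvge cf (cvg_cst _).
near=> n.
have k0 : (0 < k n)%N by near: n; exact: (k_infty _ (nbhs_infty_gt 0)).
have n0 : (0 < n)%N by near: n; exact: nbhs_infty_gt.
have [z1 _ _] : is_spike (k n) (z n) by near: n; exact: spike.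
apply/andP; split.
  apply: gaussian_spike_sdp_bound => //.
  - by rewrite ltW//=; near: n; exact: beta_le.
  - by near: n; exact: (cvgr_gt _ p_over_n).
  (* 1 / 40 turns 8 times this product into at most n / 5. *)
  - have : ln (p n * 2).+1%:R * (k n).+1%:R <= 1 / 40 * n%:R :> R.
      near: n.
      by apply: near_log_sparsity_le p_infty k_infty p_over_n k_small; lra.
    by move: (_ * _) => a; lra.
by apply: probability_le1; exact: measurable_sdp_bound.
Unshelve. all: by end_near. Qed.
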